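(* With $s=\sqrt{(u_3+u_4)^2-4u_1u_2}$, $$\sum_{n\ge0}\Bigl(\sum_{\sigma\in\mathfrak S_n}(u_1u_2)^{{\rm L}(\sigma)}u_3^{{\rm lrda}(\sigma)}u_4^{{\rm dd}(\sigma)}\beta^{{\rm RLmin}(\sigma)}\Bigr)\frac{t^n}{n!}=e^{\frac{\beta}{2}(u_3-u_4)t}\left(\cosh\Bigl(\frac{st}{2}\Bigr)-\frac{u_3+u_4}{s}\sinh\Bigl(\frac{st}{2}\Bigr)\right)^{-\beta}.$$
   Context: For $\sigma=\sigma_1\cdots\sigma_n\in\mathfrak S_n$ ($\mathfrak S_0$ = empty permutation, contributing $1$): ${\rm L}(\sigma)$ is the number of $i$ with $1\le i<n$ and $\sigma_{i-1}<\sigma_i>\sigma_{i+1}$ (convention $\sigma_0=0$); ${\rm lrda}(\sigma)$ (left-right double ascents) is the number of $i$ with $1\le i\le n$ and $\sigma_{i-1}<\sigma_i<\sigma_{i+1}$ (conventions $\sigma_0=0$, $\sigma_{n+1}=+\infty$); ${\rm dd}(\sigma)$ is the number of $i$ with $1<i<n$ and $\sigma_{i-1}>\sigma_i>\sigma_{i+1}$; ${\rm RLmin}(\sigma)$ is the number of $i$ with $\sigma_j>\sigma_i$ for all $j>i$. Series are formal power series in $t$; the bracketed series depends only on $s^2$, has constant term $1$, and $G^c:=\exp(c\log G)$. *)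

(* Defs.v *)
(* Formal power series in t are represented by their
   coefficient sequences  nat -> R  over a number field R (characteristic 0). *)
From mathcomp Require Import all_boot all_order all_algebra all_fingroup.
Set Implicit Arguments. Unset Strict Implicit. Unset Printing Implicit Defensive.
Import Order.TTheory GRing.Theory Num.Theory.
Local Open Scope ring_scope.

Section Series.
Variable R : numFieldType.

Definition sone : nat -> R := fun n => (n == 0)%:R.
Definition smul (f g : nat -> R) : nat -> R :=
  fun n => \sum_(i < n.+1) f i * g (n - i)%N.
Definition spow (f : nat -> R) (k : nat) : nat -> R := iter k (smul f) sone.

(* exp F := sum_k F^k / k!, for F with zero constant term
   (the coefficient of t^n only involves k <= n) *)
Definition sexp (F : nat -> R) : nat -> R :=
  fun n => \sum_(k < n.+1) spow F k n / (k`!)%:R.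

(* log G := sum_{k>=1} (-1)^(k+1) (G-1)^k / k, for G with constant term 1 *)
Definition slog (G : nat -> R) : nat -> R :=
  fun n => \sum_(1 <= k < n.+1)
             ((-1) ^+ k.+1 / k%:R) * spow (fun m => G m - sone m) k n.

Definition spowc (G : nat -> R) (c : R) : nat -> R :=
  sexp (fun n => c * slog G n).

(* With D = s^2:  cosh(s t/2) = sum_k D^k t^(2k) / (2^(2k) (2k)!)  and
   sinh(s t/2)/s = sum_k D^k t^(2k+1) / (2^(2k+1) (2k+1)!) ;
   both depend only on D = s^2. *)
Definition cosh_half (D : R) : nat -> R :=
  fun n => if odd n then 0 else D ^+ n./2 / (2 ^+ n * (n`!)%:R).
Definition sinhc_half (D : R) : nat -> R :=
  fun n => if odd n then D ^+ n./2 / (2 ^+ n * (n`!)%:R) else 0.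

Definition bracket (u1 u2 u3 u4 : R) : nat -> R :=
  let D := (u3 + u4) ^+ 2 - 4%:R * u1 * u2 in
  fun n => cosh_half D n - (u3 + u4) * sinhc_half D n.

Definition slin (a : R) : nat -> R := fun n => if n == 1%N then a else 0.

Definition rhs (u1 u2 u3 u4 beta : R) : nat -> R :=
  smul (sexp (slin (beta / 2%:R * (u3 - u4))))
       (spowc (bracket u1 u2 u3 u4) (- beta)).

End Series.

Local Open Scope nat_scope.
(* For s : 'S_n, the one-line word sigma_1 ... sigma_n with values in 1..n,
   padded with sigma_0 = 0 in front: psig s i = sigma_i for 0 <= i <= n. *)
Definition pword n (s : 'S_n) : seq nat := [seq (val (s i)).+1 | i <- enum 'I_n].
Definition psig n (s : 'S_n) (i : nat) : nat := nth 0 (0 :: pword s) i.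

Definition statL n (s : 'S_n) : nat :=
  count (fun i => (psig s i.-1 < psig s i) && (psig s i.+1 < psig s i))
        (iota 1 n.-1).
(* lrda: 1 <= i <= n with sigma_{i-1} < sigma_i < sigma_{i+1}, sigma_{n+1}=+oo *)
Definition statlrda n (s : 'S_n) : nat :=
  count (fun i => (psig s i.-1 < psig s i) && ((i == n) || (psig s i < psig s i.+1)))
        (iota 1 n).
Definition statdd n (s : 'S_n) : nat :=
  count (fun i => (psig s i < psig s i.-1) && (psig s i.+1 < psig s i))
        (iota 2 (n - 2)).
Definition statRLmin n (s : 'S_n) : nat :=
  count (fun i => all (fun j => psig s i < psig s j) (iota i.+1 (n - i)))
        (iota 1 n).

Local Open Scope ring_scope.
(* coefficient of t^n/n! on the left-hand side *)
Definition lhs_coef (R : numFieldType) (u1 u2 u3 u4 beta : R) (n : nat) : R :=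
  \sum_(s : 'S_n) ((u1 * u2) ^+ statL s * u3 ^+ statlrda s * u4 ^+ statdd s
                   * beta ^+ statRLmin s).

(* Main.v *)
(* Cut a permutation at its smallest letter 1, with sigma_0 = 0 on the left and
   sigma_(n+1) = +oo on the right.  The part before 1 is a word between two
   boundaries smaller than all its letters, the part after 1 is again a word
   between 0 and +oo, and 1 is a right-to-left minimum to the right of which all
   other right-to-left minima lie.  If A is the exponential generating function
   of the nonempty words between two small boundaries, this gives
   F' = beta (u3 + A) F for the left-hand side F, and cutting the words counted
   by A at their minimum gives the Riccati equation
   A' = u1 u2 + (u3 + u4) A + A^2, with A(0) = 0.  Its solution is
   A = - (u3 + u4) / 2 - G' / G, where G is the bracket, because
   G'' = (s^2 / 4) G; the right-hand side then satisfies the same linear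
   equation as F. *)
From HB Require Import structures.
Require Import Defs.
From mathcomp Require Import all_boot all_order all_algebra all_fingroup.
From mathcomp Require Import boolp ring.
Import Order.TTheory GRing.Theory Num.Theory.
Local Open Scope ring_scope.

(** * Formal power series: ring structure, derivation, exponential and logarithm *)

Section FormalSeries.
Set Implicit Arguments.
Unset Strict Implicit.
Variable R : numFieldType.
Implicit Types (a b x : R) (c : nat -> R).

(* An alias of [nat -> R], so that [*] is the Cauchy product. *)
Definition series : Type := nat -> R.
Implicit Types f g h F G : series.

HB.instance Definition _ := gen_eqMixin series.
HB.instance Definition _ := gen_choiceMixin series.

Definition sadd f g : series := fun n => f n + g n.
Definition sopp f : series := fun n => - f n.
Definition szero : series := fun=> 0.

Lemma saddA : associative sadd.
Proof. by move=> f g h; apply: funext => n; rewrite /sadd addrA. Qed.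

Lemma saddC : commutative sadd.
Proof. by move=> f g; apply: funext => n; rewrite /sadd addrC. Qed.

Lemma sadd0 : left_id szero sadd.
Proof. by move=> f; apply: funext => n; rewrite /sadd add0r. Qed.

Lemma saddN : left_inverse szero sopp sadd.
Proof. by move=> f; apply: funext => n; rewrite /sadd addNr. Qed.

HB.instance Definition _ := GRing.isZmodule.Build series saddA saddC sadd0 saddN.

(** Coefficients up to [N] of a product only see these polynomials, so commutativity, associativity
    and the Leibniz rule are inherited from [{poly R}]. *)
Definition trunc N f : {poly R} := \poly_(i < N.+1) f i.

Lemma coef_trunc N f n : (n <= N)%N -> (trunc N f)`_n = f n.
Proof. by move=> le_nN; rewrite coef_poly ltnS le_nN. Qed.

Lemma smulE N f g n : (n <= N)%N -> smul f g n = (trunc N f * trunc N g)`_n.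
Proof.
move=> le_nN; rewrite coefM; apply: eq_bigr => i _.
rewrite !coef_trunc //; first exact: leq_trans (leq_subr _ _) le_nN.
by apply: leq_trans le_nN; rewrite -ltnS.
Qed.

Lemma smulA : associative (@smul R : series -> series -> series).
Proof.
move=> f g h; apply: funext => n.
transitivity ((trunc n f * trunc n g * trunc n h)`_n); last first.
  rewrite coefM; apply: eq_bigr => i _; rewrite coef_trunc ?leq_subr //.
  by rewrite -smulE // -ltnS.
rewrite -mulrA coefM; apply: eq_bigr => i _.
rewrite coef_trunc; last by rewrite -ltnS.
by rewrite -smulE ?leq_subr.
Qed.

Lemma smulC : commutative (@smul R : series -> series -> series).
Proof.
by move=> f g; apply: funext => n; rewrite (smulE f g (leqnn n)) mulrC -smulE.
Qed.

Lemma smul1 : left_id (@sone R) (@smul R).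
Proof.
move=> f; apply: funext => n; rewrite /smul big_ord_recl subn0 mul1r.
by rewrite big1 ?addr0 // => i _; rewrite mul0r.
Qed.

Lemma smulDl : left_distributive (@smul R) sadd.
Proof.
move=> f g h; apply: funext => n; rewrite /smul /sadd -big_split.
by apply: eq_bigr => i _; rewrite mulrDl.
Qed.

Lemma sone_neq0 : (sone R : series) != 0.
Proof.
by apply/eqP => /(congr1 (fun f : series => f 0%N)) /eqP; rewrite oner_eq0.
Qed.

HB.instance Definition _ := GRing.Zmodule_isComNzRing.Build series
  smulA smulC smul1 smulDl sone_neq0.

Lemma coefs_mul f g n : (f * g) n = \sum_(i < n.+1) f i * g (n - i)%N.
Proof. by []. Qed.

Lemma coefs_mul0 f g : (f * g) 0%N = f 0%N * g 0%N.
Proof. by rewrite coefs_mul big_ord1. Qed.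

Lemma coefsD f g n : (f + g) n = f n + g n.
Proof. by []. Qed.

Lemma coefsN f n : (- f) n = - f n.
Proof. by []. Qed.

Lemma coefsB f g n : (f - g) n = f n - g n.
Proof. by []. Qed.

Lemma coefs_sum I (r : seq I) (P : pred I) (F : I -> series) n :
  (\sum_(i <- r | P i) F i) n = \sum_(i <- r | P i) F i n.
Proof. exact: (big_morph (fun f : series => f n)). Qed.

Lemma spowE f k : spow f k = f ^+ k.
Proof. by elim: k => // k IH; rewrite exprS -IH. Qed.

Definition sC a : series := fun n => if n is 0 then a else 0.

Lemma coefs_mulC a f n : (sC a * f) n = a * f n.
Proof.
rewrite coefs_mul big_ord_recl subn0 big1 ?addr0 // => i _.
by rewrite /= mul0r.
Qed.

Lemma sC_is_zmod_morphism : zmod_morphism sC.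
Proof.
by move=> a b; apply: funext => -[|n] //; rewrite coefsB /= subr0.
Qed.

Lemma sC_is_monoid_morphism : monoid_morphism sC.
Proof.
split; first by apply: funext => -[].
move=> a b; apply: funext => n; rewrite coefs_mulC.
by case: n => //= n; rewrite mulr0.
Qed.

HB.instance Definition _ :=
  GRing.isZmodMorphism.Build R series sC sC_is_zmod_morphism.
HB.instance Definition _ :=
  GRing.isMonoidMorphism.Build R series sC sC_is_monoid_morphism.

Definition sderiv f : series := fun n => n.+1%:R * f n.+1.

Lemma coefs_deriv f n : sderiv f n = n.+1%:R * f n.+1.
Proof. by []. Qed.

Lemma sderiv_is_zmod_morphism : zmod_morphism sderiv.
Proof. by move=> f g; apply: funext => n; rewrite /sderiv [LHS]mulrBr. Qed.

HB.instance Definition _ :=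
  GRing.isZmodMorphism.Build series series sderiv sderiv_is_zmod_morphism.

Lemma sderivC a : sderiv (sC a) = 0.
Proof. by apply: funext => n; rewrite /sderiv mulr0. Qed.

Lemma sderiv1 : sderiv 1 = 0.
Proof. by rewrite -(rmorph1 sC) sderivC. Qed.

Lemma trunc_deriv f N n : (n <= N)%N ->
  ((trunc N.+1 f)^`())`_n = (trunc N (sderiv f))`_n.
Proof.
by move=> le_nN; rewrite coef_deriv !coef_trunc // -mulr_natl.
Qed.

Lemma sderivM f g : sderiv (f * g) = sderiv f * g + f * sderiv g.
Proof.
apply: funext => n; rewrite {1}/sderiv.
rewrite [(f * g) n.+1](smulE f g (leqnn _)) mulr_natl -coef_deriv.
rewrite derivM coefD !coefM; congr (_ + _); apply: eq_bigr => i _; congr (_ * _).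
- by rewrite trunc_deriv ?coef_trunc //; rewrite -ltnS.
- by rewrite coef_trunc // ltnW // ltnS leq_subr.
- by rewrite coef_trunc // ltnW.
- by rewrite trunc_deriv ?coef_trunc ?leq_subr.
Qed.

Lemma sderivX f k : sderiv (f ^+ k.+1) = k.+1%:R * f ^+ k * sderiv f.
Proof.
elim: k => [|k IH]; first by rewrite expr1 expr0 !mul1r.
by rewrite exprS sderivM IH [f ^+ k.+1]exprS -[k.+2%:R]natr1; ring.
Qed.

Lemma coefs_pow_eq0 f k n : f 0%N = 0 -> (n < k)%N -> (f ^+ k) n = 0.
Proof.
move=> f0; elim: k n => // k IH n; rewrite ltnS => le_nk.
rewrite exprS coefs_mul big_ord_recl f0 mul0r add0r big1 // => i _.
rewrite IH ?mulr0 //; case: n i le_nk => [[]|n] //= i lt_nk.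
by apply: leq_trans lt_nk; rewrite subSS ltnS leq_subr.
Qed.

(* Composition [c \o f]; only meaningful when [f 0 = 0]. *)
Definition scomp c f : series := fun n => \sum_(k < n.+1) c k * (f ^+ k) n.

(** As [f ^+ k] starts in degree [k] or later, every bound [N >= n] gives the same coefficient. One
    bound can then serve all degrees up to [N], so composition is handled as a finite sum of
    series. *)
Lemma scompE c f N n : f 0%N = 0 -> (n <= N)%N ->
  scomp c f n = (\sum_(k < N.+1) sC (c k) * f ^+ k) n.
Proof.
move=> f0 le_nN; rewrite coefs_sum.
rewrite -(big_mkord xpredT (fun k => (sC (c k) * f ^+ k) n)).
rewrite (@big_cat_nat _ _ _ n.+1) //= big_mkord.
rewrite [X in _ + X]big_nat_cond [X in _ + X]big1 => [|k]; last first.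
  by rewrite andbT => /andP[lt_nk _]; rewrite coefs_mulC coefs_pow_eq0 ?mulr0.
by rewrite addr0; apply: eq_bigr => k _; rewrite coefs_mulC.
Qed.

Lemma scomp_mulE c f g n : f 0%N = 0 ->
  (scomp c f * g) n = ((\sum_(k < n.+1) sC (c k) * f ^+ k) * g) n.
Proof.
by move=> f0; apply: eq_bigr => i _; rewrite (scompE c f0 (N := n)) // -ltnS.
Qed.

Lemma sderiv_comp c f : f 0%N = 0 ->
  sderiv (scomp c f) = scomp (sderiv c) f * sderiv f.
Proof.
(* Coefficient [n] of the derivative needs the sum up to [k = n.+1]; its term [k = 0] is constant
   and dies, which leaves the [n.+1] terms of the right-hand side. *)
move=> f0; apply: funext => n; rewrite coefs_deriv (scompE c f0 (leqnn _)).
rewrite -coefs_deriv scomp_mulE // mulr_suml raddf_sum.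
rewrite big_ord_recl /= expr0 mulr1 sderivC add0r; congr (_ n).
apply: eq_bigr => k _; rewrite sderivM sderivC mul0r add0r sderivX.
rewrite -[sderiv c k]/(k.+1%:R * c k.+1) /bump /= add1n rmorphM rmorph_nat.
by rewrite mulrA mulrA [sC _ * _]mulrC.
Qed.

Lemma scomp0 c f : scomp c f 0%N = c 0%N.
Proof. by rewrite /scomp big_ord1 expr0 mulr1. Qed.

Lemma sexpE f : (sexp f : series) = scomp (fun k => k`!%:R^-1) f.
Proof.
by apply: funext => n; apply: eq_bigr => k _; rewrite spowE mulrC.
Qed.

Lemma sderiv_exp f : f 0%N = 0 -> sderiv (sexp f) = (sexp f : series) * sderiv f.
Proof.
move=> f0; rewrite sexpE sderiv_comp //; congr (scomp _ _ * _).
apply: funext => k; rewrite /sderiv factS natrM invfM mulrA mulfV ?mul1r //.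
by rewrite pnatr_eq0.
Qed.

Lemma sexp0 f : sexp f 0%N = 1.
Proof. by rewrite sexpE scomp0 invr1. Qed.

Lemma slogE f : (slog f : series) = scomp (fun k => (-1) ^+ k.+1 / k%:R) (f - 1).
Proof.
(* The extra term [k = 0] vanishes because the inverse of [0] is [0]. *)
apply: funext => n; rewrite /scomp big_ord_recl invr0 mulr0 mul0r add0r.
by rewrite /slog big_add1 big_mkord; apply: eq_bigr => k _; rewrite spowE.
Qed.

Lemma slog0 f : slog f 0%N = 0.
Proof. by rewrite slogE scomp0 invr0 mulr0. Qed.

(** The partial sums telescope to [1 - (- f) ^+ n.+1], whose last power does not reach degree [n].
    This provides both the derivative of the logarithm and inverses of series with constant term
    [1]. *)
Lemma scomp_geometric f : f 0%N = 0 ->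
  scomp (fun k => (-1) ^+ k) f * (1 + f) = 1.
Proof.
move=> f0; apply: funext => n; rewrite scomp_mulE //.
have -> : \sum_(k < n.+1) sC ((-1) ^+ k) * f ^+ k = \sum_(k < n.+1) (- f) ^+ k.
  by apply: eq_bigr => k _; rewrite rmorphXn rmorphN1 -exprMn mulN1r.
have -> : (\sum_(k < n.+1) (- f) ^+ k) * (1 + f) = 1 - (- f) ^+ n.+1.
  by rewrite -(opprB _ 1) subrX1; ring.
have nf0 : (- f) 0%N = 0 by rewrite coefsN f0 oppr0.
by rewrite coefsB coefs_pow_eq0 // subr0.
Qed.

(** The logarithmic derivative in division-free form: differentiating the logarithm series termwise
    gives the geometric series in [f - 1], an inverse of [f]. *)
Lemma sderiv_log f : f 0%N = 1 -> sderiv (slog f) * f = sderiv f.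
Proof.
move=> f0; have g0 : (f - 1) 0%N = 0 by rewrite coefsB f0 subrr.
rewrite slogE sderiv_comp // raddfB /= sderiv1 subr0.
have -> : sderiv (fun k => (-1) ^+ k.+1 / k%:R) = fun k => (-1) ^+ k.
  apply: funext => k; rewrite /sderiv mulrCA mulfV ?mulr1 ?pnatr_eq0 //.
  by rewrite 2!exprS !mulN1r opprK.
rewrite mulrAC -[X in _ * X * _](subrK 1 f) [f - 1 + 1]addrC.
by rewrite scomp_geometric // mul1r.
Qed.

Lemma smulI f g h : h 0%N = 1 -> f * h = g * h -> f = g.
Proof.
move=> h0 /eqP; rewrite -subr_eq0 -mulrBl => /eqP fgh.
have k0 : (h - 1) 0%N = 0 by rewrite coefsB h0 subrr.
apply/eqP; rewrite -subr_eq0; apply/eqP.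
rewrite -[LHS]mulr1 -(scomp_geometric k0) mulrCA.
by rewrite [1 + (h - 1)]addrC subrK fgh mulr0.
Qed.

End FormalSeries.

(** * Differential equations for the bracket and the right-hand side *)

Section DifferentialEquations.
Set Implicit Arguments.
Unset Strict Implicit.
Variables (R : numFieldType) (u1 u2 u3 u4 beta : R).

Local Notation D := ((u3 + u4) ^+ 2 - 4%:R * u1 * u2).
Let G : series R := bracket u1 u2 u3 u4.
Let L : series R := sderiv (slog G).

Lemma bracket0 : G 0%N = 1.
Proof.
by rewrite /G /bracket /cosh_half /sinhc_half /= mulr0 subr0 mulr1 invr1 mulr1.
Qed.

Lemma bracket1 : G 1%N = - ((u3 + u4) / 2%:R).
Proof.
by rewrite /G /bracket /cosh_half /sinhc_half /= sub0r expr1 mulr1 div1r.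
Qed.

Lemma bracket_deriv2 : sderiv (sderiv G) = sC (D / 4%:R) * G.
Proof.
apply: funext => n; rewrite !coefs_deriv coefs_mulC.
(* A shift by two keeps the parity, so the cosh part and the sinh part are checked separately, each
   on its own parity. *)
rewrite /G /bracket /cosh_half /sinhc_half /= negbK.
have n1 : 1 + n%:R != 0 :> R by rewrite addrC natr1 pnatr_eq0.
have n2 : 2 + n%:R != 0 :> R by rewrite -natrD pnatr_eq0.
have nf : n`!%:R != 0 :> R by rewrite pnatr_eq0 -lt0n fact_gt0.
have n3 : (2 : R) ^+ n != 0 by rewrite expf_neq0 ?pnatr_eq0.
rewrite !factS !natrM !exprS.
by case: (odd n); field; rewrite nf n3 n1 n2.
Qed.

(* The exponential generating function of nonempty words that are bounded on both sides
   by letters smaller than all their own letters. *)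
Definition excursion : series R := - (sC ((u3 + u4) / 2%:R) + L).

Lemma coefs_dlog0 : L 0%N = - ((u3 + u4) / 2%:R).
Proof.
rewrite -bracket1 -[RHS]mul1r -(coefs_deriv G 0) -(sderiv_log bracket0).
by rewrite coefs_mul0 bracket0 mulr1.
Qed.

Lemma excursion0 : excursion 0%N = 0.
Proof. by rewrite /excursion coefsN coefsD coefs_dlog0 subrr oppr0. Qed.

(** [G'' = (D / 4) G] makes [L = G' / G] satisfy [L' = D / 4 - L^2]. With [a = (u3 + u4) / 2] one
    has [D / 4 = a^2 - u1 u2], so substituting [L = - a - A] produces the linear term and leaves
    [u1 u2] as the constant. *)
Lemma sderiv_excursion :
  sderiv excursion = sC (u1 * u2) + sC (u3 + u4) * excursion + excursion ^+ 2.
Proof.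
have LG : L * G = sderiv G := sderiv_log bracket0.
have dL : sderiv L = sC (D / 4%:R) - L ^+ 2.
  (* After multiplication by [G] this is [G'' = (L G)' = L' G + L^2 G]. *)
  apply: (smulI bracket0); rewrite mulrBl -bracket_deriv2 -LG sderivM -LG.
  by ring.
rewrite /excursion raddfN raddfD /= sderivC add0r dL.
set a := (u3 + u4) / 2%:R.
have -> : D / 4%:R = a ^+ 2 - u1 * u2 by rewrite /a; field.
have -> : u3 + u4 = a + a by rewrite /a; field.
by rewrite rmorphB rmorphD rmorphXn /=; ring.
Qed.

Lemma rhs0 : rhs u1 u2 u3 u4 beta 0%N = 1.
Proof. by rewrite [LHS]coefs_mul0 /spowc !sexp0 mulr1. Qed.

Lemma sderiv_rhs :
  sderiv (rhs u1 u2 u3 u4 beta) =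
    sC beta * (sC u3 + excursion) * (rhs u1 u2 u3 u4 beta : series R).
Proof.
pose E : series R := sexp (slin (beta / 2%:R * (u3 - u4))).
pose H : series R := spowc G (- beta).
have dE : sderiv E = E * sC (beta / 2%:R * (u3 - u4)).
  rewrite sderiv_exp //; congr (_ * _); apply: funext => -[|n].
    by rewrite coefs_deriv mul1r.
  by rewrite coefs_deriv mulr0.
have dH : sderiv H = H * (sC (- beta) * L).
  have -> : H = sexp (sC (- beta) * (slog G : series R)).
    by congr sexp; apply: funext => n; rewrite coefs_mulC.
  rewrite sderiv_exp ?coefs_mulC ?slog0 ?mulr0 //.
  by rewrite sderivM sderivC mul0r add0r.
rewrite -[rhs _ _ _ _ _]/(E * H) sderivM dE dH /excursion.
(* This form exhibits the constant [(u3 + u4) / 2] of [excursion]. *)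
have -> : beta / 2%:R * (u3 - u4) = beta * (u3 - (u3 + u4) / 2%:R) by field.
by rewrite rmorphM rmorphB rmorphN /=; ring.
Qed.

End DifferentialEquations.

(** * Cutting permutations of a list at a chosen letter *)

Section Splits.
Set Implicit Arguments.
Unset Strict Implicit.

(** Both halves keep the order of [s], so a sorted alphabet splits into sorted alphabets. *)
Fixpoint splits (T : Type) (s : seq T) : seq (seq T * seq T) :=
  if s is x :: s' then
    [seq (x :: p.1, p.2) | p <- splits s'] ++ [seq (p.1, x :: p.2) | p <- splits s']
  else [:: ([::], [::])].

Lemma filter_splits (T : eqType) (P : pred T) s :
  (filter P s, filter (predC P) s) \in splits s.
Proof.
elim: s => [|x s IH] //=; rewrite mem_cat; case: (P x) => /=; apply/orP.
- by left; apply/mapP; exists (filter P s, filter (predC P) s).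
- by right; apply/mapP; exists (filter P s, filter (predC P) s).
Qed.

Lemma splits_perm (T : eqType) (s : seq T) p :
  p \in splits s -> perm_eq (p.1 ++ p.2) s.
Proof.
elim: s p => [|x s IH] p /=; first by rewrite inE => /eqP ->.
rewrite mem_cat => /orP[] /mapP[q /IH q_s ->] /=; first by rewrite perm_cons.
by rewrite perm_catC /= perm_cons perm_catC.
Qed.

Lemma splits_subseq (T : eqType) (s : seq T) p :
  p \in splits s -> subseq p.1 s /\ subseq p.2 s.
Proof.
elim: s p => [|x s IH] p /=; first by rewrite inE => /eqP ->.
rewrite mem_cat => /orP[] /mapP[q /IH[q1 q2] ->] /=; rewrite eqxx; split=> //.
  exact: subseq_trans q2 (subseq_cons _ _).
exact: subseq_trans q1 (subseq_cons _ _).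
Qed.

(** Pascal's rule, according to the side that receives the head. It turns sums over splits into the
    binomial convolution behind products of exponential generating functions. *)
Lemma big_splits (R : pzSemiRingType) (T : Type) (s : seq T) (h : nat -> nat -> R) :
  \sum_(p <- splits s) h (size p.1) (size p.2) =
    \sum_(k < (size s).+1) 'C(size s, k)%:R * h k (size s - k)%N.
Proof.
elim: s h => [|x s IH] h /=; first by rewrite big_seq1 big_ord1 bin0 mul1r.
rewrite big_cat !big_map /= (IH (fun i => h i.+1)) (IH (fun i j => h i j.+1)).
set n := size s; rewrite [RHS]big_ord_recl.
(* The term [k = 0] is taken out and the vanishing ['C(n, n.+1)] is added, so that both sums have
   the same range. *)
rewrite [X in _ + X](_ : _ =
    h 0%N n.+1 + \sum_(k < n.+1) 'C(n, k.+1)%:R * h k.+1 (n - k)%N); last first.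
  rewrite big_ord_recl [in RHS]big_ord_recr /= bin0 mul1r subn0.
  rewrite bin_small // mul0r addr0; congr (_ + _); apply: eq_bigr => k _.
  by rewrite /bump add1n subnSK.
rewrite bin0 mul1r subn0 addrCA; congr (_ + _); rewrite -big_split.
apply: eq_bigr => k _ /=.
by rewrite /bump add1n subSS binS natrD addrC mulrDl.
Qed.

Definition perms_around (T : eqType) (m : T) (s : seq T) : seq (seq T) :=
  [seq q.1 ++ m :: q.2 | q <- [seq q | p <- splits s,
     q <- [seq (t1, t2) | t1 <- permutations p.1, t2 <- permutations p.2]]].

(** Cutting at [m] shows one inclusion. The lengths agree, as the sum of ['C(n, k) k! (n - k)!] over
    [k <= n] is [(n + 1)!], and the included list is duplicate-free, so the two lists agree up to
    order. *)
Lemma permutations_around (T : eqType) (m : T) s : uniq (m :: s) ->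
  perm_eq (permutations (m :: s)) (perms_around m s).
Proof.
move=> uniq_ms.
have [m_s uniq_s] : m \notin s /\ uniq s by apply/andP.
have sub : {subset permutations (m :: s) <= perms_around m s}.
  move=> t; rewrite mem_permutations => t_ms.
  have m_t : m \in t by rewrite (perm_mem t_ms) mem_head.
  case/splitPr: m_t t_ms => t1 t2; rewrite perm_catC /= perm_cons => t_s.
  have uniq_t : uniq (t2 ++ t1) by rewrite (perm_uniq t_s).
  move: (uniq_t); rewrite cat_uniq => /and3P[uniq_t2 t21 uniq_t1].
  apply/mapP; exists (t1, t2) => //; apply/flatten_mapP.
  (* The letters on each side of [m], listed in the order of [s]. *)
  exists (filter (mem t1) s, filter (predC (mem t1)) s); first exact: filter_splits.
  rewrite map_id; apply/allpairsP; exists (t1, t2); split=> //=;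
    rewrite mem_permutations; apply: uniq_perm; rewrite ?filter_uniq // => x;
    rewrite mem_filter -(perm_mem t_s) mem_cat /=.
  - by case: (x \in t1); rewrite ?orbT.
  - case x1: (x \in t1) => /=; last by rewrite orbF.
    by apply: contraNF t21 => x2; apply/hasP; exists x.
have size_eq : size (perms_around m s) = size (permutations (m :: s)).
  rewrite size_permutations // size_map size_allpairs_dep sumnE big_map.
  under eq_big_seq => p p_s.
    have := splits_perm p_s => /perm_uniq; rewrite uniq_s cat_uniq.
    move=> /and3P[uniq1 _ uniq2].
    rewrite size_allpairs !size_permutations //.
  over.
  have := big_splits s (fun i j => i`! * j`!)%N; rewrite /= => ->.
  transitivity (\sum_(k < (size s).+1) (size s)`!)%N.
    by apply: eq_bigr => k _; rewrite natn; apply: bin_fact; rewrite -ltnS.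
  by rewrite sum_nat_const card_ord.
apply: uniq_perm; first exact: permutations_uniq.
  by apply: leq_size_uniq sub _; rewrite ?permutations_uniq // size_eq.
by apply: (uniq_min_size _ sub _).2; rewrite ?permutations_uniq // size_eq.
Qed.

Lemma sum_permutations_cons (R : nmodType) (T : eqType) (m : T) s (F : seq T -> R) :
  uniq (m :: s) ->
  \sum_(t <- permutations (m :: s)) F t =
    \sum_(p <- splits s) \sum_(t1 <- permutations p.1) \sum_(t2 <- permutations p.2)
       F (t1 ++ m :: t2).
Proof.
move=> uniq_ms; rewrite (perm_big _ (permutations_around uniq_ms)) big_map.
rewrite big_allpairs_dep; apply: eq_bigr => p _.
by rewrite big_allpairs.
Qed.

End Splits.

(** * Weighted words and their exponential generating functions *)

Section Weights.
Set Implicit Arguments.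
Unset Strict Implicit.
Variables (R : numFieldType) (u1 u2 u3 u4 beta : R).
Implicit Types (l m r x y : nat) (s t w : seq nat).

(** The cases are, in order, peak, double ascent, double descent and valley. *)
Definition letter_weight l x y : R :=
  if (l < x)%N then if (y < x)%N then u1 * u2 else u3
  else if (y < x)%N then u4 else 1.

(* [l] and [r] play the roles of sigma_0 and sigma_(n+1). *)
Fixpoint word_weight l w r : R :=
  if w is x :: w' then letter_weight l x (head r w') * word_weight x w' r else 1.

Fixpoint rlmin w : nat :=
  if w is x :: w' then all (ltn x) w' + rlmin w' else 0.

(** A letter's weight depends only on its two neighbours, so the cut letter [m] becomes a boundary
    of both halves. *)
Lemma word_weight_cat l w1 m w2 r :
  word_weight l (w1 ++ m :: w2) r =
    word_weight l w1 m * letter_weight (last l w1) m (head r w2) * word_weight m w2 r.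
Proof.
elim: w1 l => [|x w1 IH] l /=; first by rewrite mul1r.
by rewrite IH !mulrA; case: w1 {IH}.
Qed.

Lemma rlmin_cat w1 m w2 : all (ltn m) w1 -> all (ltn m) w2 ->
  rlmin (w1 ++ m :: w2) = (rlmin w2).+1.
Proof.
move=> + m_w2; elim: w1 => [|x w1 IH] /=; first by rewrite m_w2.
case/andP=> lt_mx /IH ->.
by rewrite all_cat /= [(x < m)%N]ltnNge (ltnW lt_mx) andbF.
Qed.

Lemma all_ltn_last l m w : (l < m)%N -> all (ltn m) w ->
  (last l w < m)%N = nilp w.
Proof.
move=> lm; case/lastP: w => [//|w x]; rewrite all_rcons last_rcons => /andP[mx _].
by rewrite /nilp size_rcons /= ltnNge ltnW.
Qed.

(* Total weight of the words on [k] given letters with small boundaries on both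
   sides, divided by [k`!]; the empty word counts [1], not [excursion 0]. *)
Definition excursion1 k : R := if k is 0 then 1 else excursion u1 u2 u3 u4 k.

Lemma split_fact (a b : nat -> R) (h : nat -> nat -> R) n :
  \sum_(k < n.+1) 'C(n, k)%:R *
     (h k (n - k)%N * (k`!%:R * a k) * ((n - k)`!%:R * b (n - k)%N))
   = n`!%:R * \sum_(k < n.+1) h k (n - k)%N * a k * b (n - k)%N.
Proof.
rewrite mulr_sumr; apply: eq_bigr => k _.
have le_kn : (k <= n)%N by rewrite -ltnS.
by rewrite -(bin_fact le_kn) !natrM; ring.
Qed.

Lemma sum_splits (a b : nat -> R) (h : nat -> nat -> R) s :
  \sum_(p <- splits s) h (size p.1) (size p.2) *
     ((size p.1)`!%:R * a (size p.1)) * ((size p.2)`!%:R * b (size p.2))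
  = (size s)`!%:R * \sum_(k < (size s).+1) h k (size s - k)%N * a k * b (size s - k)%N.
Proof.
rewrite -split_fact.
exact: (big_splits _ (fun i j => h i j * (i`!%:R * a i) * (j`!%:R * b j))).
Qed.

(** The weight of the minimum of a word between two smaller boundaries, with [i] letters before it
    and [j] after it: a side is descending away from it exactly when that side is empty. *)
Definition peak_weight i j : R :=
  if i is 0 then if j is 0 then u1 * u2 else u3 else if j is 0 then u4 else 1.

(** The Riccati equation read coefficientwise: for [n > 0] the terms [k = 0] and [k = n] give the
    linear part, with [u3] and [u4], and the others give the square. *)
Lemma excursion1_rec n :
  \sum_(k < n.+1) peak_weight k (n - k) * excursion1 k * excursion1 (n - k)%N
    = n.+1%:R * excursion1 n.+1.
Proof.
have A0 := excursion0 u1 u2 u3 u4.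
rewrite -[RHS]/(sderiv (excursion u1 u2 u3 u4) n) sderiv_excursion expr2.
rewrite !coefsD coefs_mulC coefs_mul.
(* For [n = 0] the two extreme terms coincide and give [u1 * u2]. *)
case: n => [|n]; first by rewrite !big_ord1 A0 !mulr0 !addr0 /= !mulr1.
rewrite add0r [in LHS]big_ord_recl [in LHS]big_ord_recr /= !subSS subnn.
rewrite big_ord_recl big_ord_recr A0 mul0r add0r subn0 !subSS subnn /= A0 !mulr0 addr0.
rewrite !mulr1 addrCA -mulrDl addrC; congr (_ + _).
apply: eq_bigr => i _; rewrite /bump /= !add1n subSS.
by rewrite -(subnSK (ltn_ord i)) mul1r.
Qed.

Lemma letter_weight_min l m r s t1 t2 :
  (l < m)%N -> (r < m)%N -> all (ltn m) s -> perm_eq (t1 ++ t2) s ->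
  letter_weight (last l t1) m (head r t2) = peak_weight (size t1) (size t2).
Proof.
move=> lm rm m_s /perm_all p_s; move: m_s; rewrite -p_s all_cat => /andP[m1 m2].
rewrite /letter_weight all_ltn_last //.
have -> : (head r t2 < m)%N = nilp t2.
  by case: t2 {p_s} m2 => [_|x t2 /andP[mx _]] //=; rewrite ltnNge ltnW.
by case: t1 {p_s m1} => [|? ?]; case: t2 {m2}.
Qed.

Lemma perm_eq_cat_splits s p t1 t2 : p \in splits s ->
  t1 \in permutations p.1 -> t2 \in permutations p.2 ->
  [/\ size t1 = size p.1, size t2 = size p.2 & perm_eq (t1 ++ t2) s].
Proof.
rewrite !mem_permutations => p_s t1p t2p; split; try exact: perm_size.
by apply: perm_trans (splits_perm p_s); apply: perm_cat.
Qed.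

(** Since [s] is sorted, its head [m] is the minimum. The halves are again bounded by smaller
    letters, by [l] and [m] on the left and by [m] and [r] on the right, hence an induction over all
    boundaries. *)
Lemma sum_word_weight s l r : path ltn l s -> all (ltn r) s ->
  \sum_(t <- permutations s) word_weight l t r = (size s)`!%:R * excursion1 (size s).
Proof.
have [n] := ubnP (size s); elim: n s l r => // n IH [|m s] l r.
  by rewrite big_seq1 /= mul1r.
rewrite ltnS => /= le_sn /andP[lm path_s] /andP[rm _].
have m_s : all (ltn m) s := order_path_min ltn_trans path_s.
have uniq_ms : uniq (m :: s) by apply: (sorted_uniq ltn_trans ltnn).
rewrite sum_permutations_cons //.
transitivity (\sum_(p <- splits s) peak_weight (size p.1) (size p.2) *
    ((size p.1)`!%:R * excursion1 (size p.1)) *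
    ((size p.2)`!%:R * excursion1 (size p.2))).
  apply: eq_big_seq => p p_s; have [sub1 sub2] := splits_subseq p_s.
  have [m1 m2] : path ltn m p.1 /\ path ltn m p.2.
    by split; apply: subseq_path path_s => //; apply: ltn_trans.
  rewrite -(IH p.1 l m) ?(leq_ltn_trans (size_subseq sub1)) //; last 2 first.
  - by case: p.1 m1 => //= x q /andP[mx ->]; rewrite (ltn_trans lm mx).
  - exact: order_path_min ltn_trans m1.
  rewrite -(IH p.2 m r) ?(leq_ltn_trans (size_subseq sub2)) //; last first.
    apply: sub_all (order_path_min ltn_trans m2) => x; exact: ltn_trans.
  rewrite -mulrA big_distrlr mulr_sumr /=; apply: eq_big_seq => t1 t1p.
  rewrite mulr_sumr; apply: eq_big_seq => t2 t2p.
  have [<- <- t_s] := perm_eq_cat_splits p_s t1p t2p.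
  rewrite word_weight_cat (letter_weight_min lm rm m_s t_s).
  by rewrite mulrCA mulrA.
by rewrite sum_splits excursion1_rec factS natrM mulrCA mulrA.
Qed.

Lemma sum_word_weight_rlmin s l r : path ltn l s -> all (gtn r) s ->
  \sum_(t <- permutations s) word_weight l t r * beta ^+ rlmin t =
    (size s)`!%:R * rhs u1 u2 u3 u4 beta (size s).
Proof.
have [n] := ubnP (size s); elim: n s l r => // n IH [|m s] l r.
  by rewrite big_seq1 /= rhs0 !mulr1.
rewrite ltnS => /= le_sn /andP[lm path_s] /andP[mr s_r].
have m_s : all (ltn m) s := order_path_min ltn_trans path_s.
have uniq_ms : uniq (m :: s) by apply: (sorted_uniq ltn_trans ltnn).
rewrite sum_permutations_cons //.
(* The weight of [m] with its factor [beta] as a right-to-left minimum: its right neighbour is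
   larger, be it a letter or [r], so [m] is a double ascent if nothing precedes it and a valley
   otherwise. *)
pose h i (j : nat) : R := beta * if i is 0 then u3 else 1.
transitivity (\sum_(p <- splits s) h (size p.1) (size p.2) *
    ((size p.1)`!%:R * excursion1 (size p.1)) *
    ((size p.2)`!%:R * rhs u1 u2 u3 u4 beta (size p.2))).
  apply: eq_big_seq => p p_s; have [sub1 sub2] := splits_subseq p_s.
  have [m1 m2] : path ltn m p.1 /\ path ltn m p.2.
    by split; apply: subseq_path path_s => //; apply: ltn_trans.
  rewrite -(@sum_word_weight p.1 l m); last 2 first.
  - by case: p.1 m1 => //= x q /andP[mx ->]; rewrite (ltn_trans lm mx).
  - exact: order_path_min ltn_trans m1.
  rewrite -(IH p.2 m r) ?(leq_ltn_trans (size_subseq sub2)) //; last first.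
    by apply/allP => x /(mem_subseq sub2) /(allP s_r).
  rewrite -mulrA big_distrlr mulr_sumr /=; apply: eq_big_seq => t1 t1p.
  rewrite mulr_sumr; apply: eq_big_seq => t2 t2p.
  have [<- _ t_s] := perm_eq_cat_splits p_s t1p t2p.
  move: m_s s_r; rewrite -!(perm_all _ t_s) !all_cat => /andP[m_t1 m_t2] /andP[_ t2_r].
  rewrite word_weight_cat rlmin_cat // exprS.
  have -> : letter_weight (last l t1) m (head r t2) = if size t1 is 0 then u3 else 1.
    rewrite /letter_weight all_ltn_last //.
    have -> : (head r t2 < m)%N = false.
      by case: (t2) m_t2 => [_|x t /andP[mx _]] /=; rewrite ltnNge ltnW.
    by case: (t1).
  by rewrite /h; case: (size t1) => [|_]; ring.
rewrite sum_splits factS natrM [_.+1%:R * _]mulrC -mulrA; congr (_ * _).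
rewrite -[RHS]/(sderiv (rhs u1 u2 u3 u4 beta) _) sderiv_rhs -mulrA coefs_mulC mulr_sumr.
apply: eq_bigr => k _; rewrite /h -!mulrA; congr (_ * _).
rewrite mulrA; congr (_ * _); rewrite coefsD.
(* The empty left half supplies [u3] and the nonempty ones supply [excursion]: together, the series
   [u3 + A]. *)
by case: (k : nat) => [|i] /=; rewrite ?excursion0 ?addr0 ?add0r ?mulr1 ?mul1r.
Qed.

End Weights.

(** * The statistics of a permutation read off its one-line word *)

Section OneLineWords.
Set Implicit Arguments.
Unset Strict Implicit.
Variables (n : nat) (s : 'S_n).
Local Open Scope nat_scope.

Lemma size_pword : size (pword s) = n.
Proof. by rewrite size_map size_enum_ord. Qed.

Lemma pword_uniq : uniq (pword s).
Proof.
by rewrite map_inj_uniq ?enum_uniq // => i j [] /ord_inj /perm_inj.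
Qed.

Lemma pword_perm : perm_eq (pword s) (iota 1 n).
Proof.
have sub : {subset pword s <= iota 1 n}.
  by move=> _ /mapP[i _ ->]; rewrite mem_iota add1n ltnS; apply: ltn_ord.
apply: uniq_perm; rewrite ?pword_uniq ?iota_uniq //.
by apply: (uniq_min_size pword_uniq sub _).2; rewrite size_iota size_pword.
Qed.

Lemma psig_neq i j : i <= n -> j <= n -> i != j -> psig s i != psig s j.
Proof.
move=> le_in le_jn; rewrite /psig nth_uniq //= ?size_pword ?ltnS // pword_uniq andbT.
by apply/mapP => -[].
Qed.

(** Exchanges the negated tests of [letter_weight] for the strict reverse tests of the
    statistics. *)
Lemma psig_ltN i j : i <= n -> j <= n -> i != j ->
  (psig s i < psig s j) = ~~ (psig s j < psig s i).
Proof. by move=> le_in le_jn /psig_neq; rewrite -leqNgt ltn_neqAle => -> . Qed.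

Lemma psig_ltn i : psig s i < n.+1.
Proof.
case: (ltnP i n.+1) => [le_in|lt_ni]; last by rewrite /psig nth_default //= size_pword.
have := mem_nth 0 (_ : i < size (0 :: pword s)); rewrite /= size_pword => /(_ le_in).
rewrite inE => /orP[/eqP|]; rewrite -/(psig s i); first by move=> ->.
by rewrite (perm_mem pword_perm) mem_iota add1n => /andP[].
Qed.

Lemma count_iota_ltn (P : pred nat) m k :
  count (fun i => (i < m + k) && P i) (iota m k.+1) = count P (iota m k).
Proof.
rewrite -addn1 iotaD count_cat /= ltnn !addn0.
by apply: eq_in_count => i; rewrite mem_iota => /andP[_ ->].
Qed.

(** The index range [1..n] is shared with [statlrda], so that the powers can be multiplied position
    by position. *)
Lemma statLE : statL s = count
  (fun i => [&& i < n, psig s i.-1 < psig s i & psig s i.+1 < psig s i]) (iota 1 n).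
Proof.
rewrite /statL; case: (n) s => [|k] r //; symmetry.
exact: (count_iota_ltn (fun i => (psig r i.-1 < psig r i) && (psig r i.+1 < psig r i))).
Qed.

Lemma statddE : statdd s = count
  (fun i => [&& i < n, psig s i < psig s i.-1 & psig s i.+1 < psig s i]) (iota 1 n).
Proof.
(* The added position [1] never counts, because [sigma_0 = 0] is not above [sigma_1]. *)
rewrite /statdd; case: (n) s => [|[|k]] r //; rewrite -[iota 1 k.+2]/(1 :: iota 2 k.+1).
rewrite /= !subSS subn0; symmetry.
exact: (count_iota_ltn (fun i => (psig r i < psig r i.-1) && (psig r i.+1 < psig r i))).
Qed.

Lemma all_iota_drop (T : Type) (x0 : T) (p : pred T) (w : seq T) i :
  i <= size w -> all (fun j => p (nth x0 w j)) (iota i (size w - i)) = all p (drop i w).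
Proof.
by move=> le_iw; rewrite -all_map map_nth_iota // take_oversize ?size_drop.
Qed.

Lemma rlminE w :
  rlmin w = count (fun i => all (ltn (nth 0 w i)) (drop i.+1 w)) (iota 0 (size w)).
Proof.
elim: w => //= x w ->; rewrite drop0; congr (_ + _).
by rewrite -[1]addn0 iotaDl count_map; apply: eq_count.
Qed.

Lemma statRLminE : statRLmin s = rlmin (pword s).
Proof.
rewrite rlminE size_pword /statRLmin -[1]addn0 iotaDl count_map.
apply: eq_in_count => i; rewrite mem_iota add0n /= => lt_in.
rewrite -(all_iota_drop 0) size_pword // add1n.
by rewrite -[i.+2]add1n iotaDl all_map.
Qed.

End OneLineWords.

(** * From sums over permutations to sums over words *)

Section PermutationSums.
Set Implicit Arguments.
Unset Strict Implicit.
Variables (R : numFieldType) (u1 u2 u3 u4 : R).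

Lemma expr_count_iota (x : R) (P : pred nat) n :
  x ^+ count P (iota 1 n) = \prod_(i < n) if P i.+1 then x else 1.
Proof.
rewrite -(big_mkord xpredT (fun i => if P i.+1 then x else 1)).
rewrite -[1%N]addn0 iotaDl count_map /index_iota subn0.
elim: (iota 0 n) => [|i w IH] /=; first by rewrite big_nil.
by rewrite big_cons -IH exprD; case: (P _); rewrite ?mul1r.
Qed.

Lemma word_weightE l w r : word_weight u1 u2 u3 u4 l w r =
  \prod_(i < size w) letter_weight u1 u2 u3 u4
     (nth 0%N (l :: w) i) (nth 0%N w i) (nth r w i.+1).
Proof.
elim: w l => [|x w IH] l; first by rewrite big_ord0.
by rewrite big_ord_recl /= nth0 IH.
Qed.

(** Both sides are products over positions: each position is counted by at most one of the three
    statistics, and valleys by none. *)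
Lemma word_weight_pword n (s : 'S_n) :
  (u1 * u2) ^+ statL s * u3 ^+ statlrda s * u4 ^+ statdd s =
  word_weight u1 u2 u3 u4 0 (pword s) n.+1.
Proof.
rewrite statLE statddE /statlrda !expr_count_iota -!big_split word_weightE size_pword.
apply: eq_bigr => i _ /=; rewrite /letter_weight.
have lt_in := ltn_ord i.
rewrite -/(psig s i) -[nth 0%N (pword s) i]/(psig s i.+1).
have neq_i : i.+1 != i by rewrite gtn_eqF.
rewrite (@psig_ltN n s i.+1 i) ?(ltnW lt_in) //.
move: (psig s i < psig s i.+1)%N => b.
have [lt_i1n|] := ltnP i.+1 n; last first.
  move=> le_ni; have -> : i.+1 = n by apply/eqP; rewrite eqn_leq lt_in.
  (* The boundary [n.+1] exceeds all letters and acts as [sigma_(n+1) = +oo]: the last letter can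
     only be a double ascent or a valley. *)
  have n1_ge : (n.+1 < psig s n)%N = false by rewrite ltnNge ltnW ?psig_ltn.
  rewrite eqxx nth_default ?size_pword // n1_ge /=.
  by rewrite andbT mul1r mulr1.
rewrite ltn_eqF //= (set_nth_default 0%N) ?size_pword //.
rewrite -[nth 0%N (pword s) i.+1]/(psig s i.+2).
rewrite (@psig_ltN n s i.+1 i.+2) //; last by rewrite neq_ltn ltnSn.
by case: b; case: (_ < _)%N; rewrite /= ?mul1r ?mulr1.
Qed.

Lemma pword_inj n : injective (@pword n).
Proof.
move=> s1 s2 eq_s; apply/permP => i; apply: val_inj; apply: succn_inj.
have /eq_in_map := eq_s; apply; exact: mem_enum.
Qed.

(** [pword] is injective into a list of the same length [n!], hence reaches all of it. *)
Lemma sum_pword n (F : seq nat -> R) :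
  \sum_(s : 'S_n) F (pword s) = \sum_(t <- permutations (iota 1 n)) F t.
Proof.
rewrite -big_enum /= -(big_map (@pword n) xpredT F); apply: perm_big.
have uniq_p : uniq [seq pword s | s <- enum 'S_n].
  by rewrite map_inj_uniq ?enum_uniq //; apply: pword_inj.
apply: uniq_perm; rewrite ?permutations_uniq //.
apply: (uniq_min_size uniq_p _ _).2.
  by move=> _ /mapP[s _ ->]; rewrite mem_permutations pword_perm.
rewrite size_permutations ?iota_uniq // size_iota size_map.
by rewrite -cardE card_Sn.
Qed.

End PermutationSums.

Theorem theorem4p1 (R : numFieldType) (u1 u2 u3 u4 beta : R) (n : nat) :
  lhs_coef u1 u2 u3 u4 beta n / (n`!)%:R = rhs u1 u2 u3 u4 beta n.
Proof.
have n_neq0 : n`!%:R != 0 :> R by rewrite pnatr_eq0 -lt0n fact_gt0.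
apply: (canLR (mulfK n_neq0)); rewrite mulrC.
have := @sum_word_weight_rlmin R u1 u2 u3 u4 beta (iota 1 n) 0 n.+1.
rewrite size_iota => <-; last 2 first.
- by have := iota_ltn_sorted 0 n.+1.
- by apply/allP => i; rewrite mem_iota add1n => /andP[].
rewrite -sum_pword; apply: eq_bigr => s _.
by rewrite word_weight_pword statRLminE.
Qed.
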